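(* Let $\mathbb{K}$ be one of the number fields $\mathbb{Q}(\sqrt{-d})$ or $\mathbb{Q}(\sqrt{d})$ for some square-free positive integer $d$, and let $\mathcal{O}_{\mathbb{K}}$ denote the ring of integers of $\mathbb{K}$. Let $S$ be the set of solutions $(x_1,x_2)\in\mathbb{K}\times\mathcal{O}_{\mathbb{K}}$ to the equation $x_1^{3}-x_2^{2}x_1+1=0$. Then: (i) if $\mathbb{K}=\mathbb{Q}(\sqrt{2})$, then $S=\{(-1,0),(1,\sqrt{2})\}$; (ii) if $\mathbb{K}=\mathbb{Q}(\sqrt{d})$ with $d\neq 2$ and condition C holds, then $S=\{(-1,0)\}$; (iii) if $\mathbb{K}=\mathbb{Q}(\sqrt{-d})$ with $d\neq 3$, then $S=\{(-1,0)\}$; (iv) if $\mathbb{K}=\mathbb{Q}(\sqrt{-3})$, then $S=\{(-1,0),(-\omega,0),(-\omega^{2},0)\}$, where $\omega=\frac{1+\sqrt{-3}}{2}$.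
   Context: Condition C on $d$: $d\equiv 2$ or $3\pmod 4$, and, writing $y=\alpha+\beta\sqrt{d}$ ($\alpha,\beta\in\mathbb{Z}$) for the minimum unit greater than $1$ in $\mathbb{Z}[\sqrt{d}]$, one has: $\alpha$ and $\beta$ are both odd if $d\equiv 2\pmod 4$; $\alpha$ is even and $\beta$ is odd if $d\equiv 3\pmod 4$.
   Formalization: Two misprints corrected: in (i) the solution (1,−√2) is added, since x_2 enters only through its square; in (iv) ω is taken as (−1+√−3)/2, because with (1+√−3)/2 one has (−ω)^3=1, so (−ω,0) is not a solution. *)

(* Defs.v *)
From mathcomp Require Export all_boot all_order all_algebra all_field.
From mathcomp Require Export boolp classical_sets.

Set Implicit Arguments.
Unset Strict Implicit.
Unset Printing Implicit Defensive.

Import Order.TTheory GRing.Theory Num.Theory.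
Local Open Scope classical_set_scope.
Local Open Scope ring_scope.

Definition square_free (d : nat) : Prop :=
  forall m : nat, (m ^ 2 %| d)%N -> m = 1%N.

(* K = Q(sqrt D), with s the square root of D adjoined to the rationals.  Since
   1 is the prime subfield of K, <<1; s>> is the subfield Q(s). *)
Definition is_Q_sqrt (D : int) (K : fieldExtType rat) (s : K) : Prop :=
  s ^+ 2 = D%:~R /\ <<1; s>>%VS = fullv.

Definition ring_of_integers (K : fieldExtType rat) : set K :=
  [set x : K | integralOver (intr : int -> K) x].
Arguments ring_of_integers : clear implicits.

Definition solutions (K : fieldExtType rat) : set (K * K) :=
  [set x : K * K | ring_of_integers K x.2 /\
                   x.1 ^+ 3 - x.2 ^+ 2 * x.1 + 1 = 0].
Arguments solutions : clear implicits.

(* Condition C compares elements of Z[sqrt d] as real numbers, so it is stated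
   in algC, where sqrtC d%:R is the nonnegative square root of d. *)
Definition Zsqrt_elt (d : nat) (a b : int) : algC :=
  a%:~R + b%:~R * sqrtC d%:R.

Definition Zsqrt (d : nat) : set algC :=
  [set x : algC | exists a b : int, x = Zsqrt_elt d a b].

Definition Zsqrt_unit (d : nat) : set algC :=
  [set x : algC | Zsqrt d x /\ exists2 y : algC, Zsqrt d y & x * y = 1].

Definition min_unit_gt1 (d : nat) (y : algC) : Prop :=
  [/\ Zsqrt_unit d y, 1 < y
    & forall z : algC, Zsqrt_unit d z -> 1 < z -> y <= z].

Definition condition_C (d : nat) : Prop :=
  (d %% 4 = 2 \/ d %% 4 = 3)%N /\
  exists a b : int,
    [/\ min_unit_gt1 d (Zsqrt_elt d a b),
        (d %% 4 = 2)%N -> odd `|a|%N /\ odd `|b|%N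
      & (d %% 4 = 3)%N -> ~~ odd `|a|%N /\ odd `|b|%N].

(* The result as published contains two sign slips, which make it false as
   printed: for Q(sqrt 2) it lists (1, sqrt 2) but not (1, - sqrt 2), although the
   equation is even in x_2, and it sets omega = (1 + sqrt(-3)) / 2, for which
   (- omega)^3 = 1, so that (- omega, 0) is not a solution.  The solution set
   {(-1, 0), (- omega, 0), (- omega^2, 0)} is the right one when omega is a
   primitive cube root of unity, as here. *)
Definition omega (K : fieldExtType rat) (s : K) : K := (-1 + s) / 2.

(* Main.v *)
(* A solution (u, t) satisfies u (t + u) (t - u) = 1, so that u, t + u and t - u
   are units.  Over an imaginary field the few units are tried one by one.
   Over a real field, t + u and t - u are congruent modulo 2; by condition C the
   units congruent to 1 modulo 2 are, up to sign, the squares of units, so that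
   t + u = e V^2 (t - u) with e = 1 or -1 and V a unit.  Then e V - V^-1 is twice
   a unit, and V^-1 = n V' for the norm n of V and its conjugate V'.  If e = n,
   the irrational part of V is a unit, which is absurd.  If e = - n, the rational
   part of V is 1 or -1, so that either V is rational and t = 0, or d = 2 and
   u^3 = 1. *)
Require Import Defs.
From mathcomp Require Import ring zify.
Set Implicit Arguments.
Unset Strict Implicit.
Unset Printing Implicit Defensive.

Import Order.TTheory GRing.Theory Num.Theory.
Local Open Scope classical_set_scope.
Local Open Scope ring_scope.

(** * Rational squares and square-free integers *)

(** Stated over the rationals because this is what makes rational coordinates with respect to 1 and
    sqrt D unique. *)
Definition nonsquare (D : int) := forall r : rat, r ^+ 2 <> D%:~R.

Lemma rat_sqr_eq (a b : int) (r : rat) :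
  a%:~R * r ^+ 2 = b%:~R -> a * numq r ^+ 2 = b * denq r ^+ 2.
Proof.
move=> e; apply: (@intr_inj rat).
rewrite intrM [RHS]intrM !rmorphXn /= -e -mulrA -exprMn; by rewrite -numqE.
Qed.

(** In lowest terms the equation reads a^2 = d b^2 with a and b not both even; as squares are 0 or 1
    modulo 4, each parity case contradicts the residue of d. *)
Lemma nonsquare_mod4 (d : nat) :
  (d %% 4 = 2 \/ d %% 4 = 3)%N -> nonsquare d%:Z.
Proof.
move=> hd r; rewrite -[r ^+ 2]mul1r => /(@rat_sqr_eq 1); rewrite mul1r.
have /eqP := coprime_num_den r.
move: (numq r) (denq r) => m n cop /(congr1 absz).
rewrite abszX abszM abszX /=.
move: cop; set a := absz m; set b := absz n => cop e.
have := divn_eq a 2; have := divn_eq b 2; have := divn_eq d 4.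
move: (ltn_pmod a (isT : 0 < 2)%N) (ltn_pmod b (isT : 0 < 2)%N).
have : ~ (2 %| a /\ 2 %| b)%N.
  case=> h1 h2; have : (2 %| gcdn a b)%N by rewrite dvdn_gcd h1 h2.
  by rewrite cop.
rewrite /dvdn; move: e hd.
move: (a %/ 2)%N (b %/ 2)%N (d %/ 4)%N (a %% 2)%N (b %% 2)%N (d %% 4)%N.
move=> a2 b2 d4 a0 b0 d0 e hd nev la lb ed eb ea.
have [a0E|a0E] : a0 = 0%N \/ a0 = 1%N by lia.
- have b0E : b0 = 1%N by lia.
  by subst a0 b0; rewrite ea eb in e; nia.
- subst a0; have [b0E|b0E] : b0 = 0%N \/ b0 = 1%N by lia.
    by subst b0; rewrite ea eb in e; nia.
  by subst b0; rewrite ea eb in e; nia.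
Qed.

Lemma nonsquare_neg (D : int) : D < 0 -> nonsquare D.
Proof.
by move=> D0 r e; have := sqr_ge0 r; rewrite e ler0z leNgt D0.
Qed.

(** With r = n/m in lowest terms, d n^2 = c m^2, so n^2 divides c and m^2 divides d. *)
Lemma square_free_eq (c d : nat) (r : rat) :
  square_free c -> square_free d -> d%:R * r ^+ 2 = c%:R -> d = c.
Proof.
move=> hc hd; rewrite !pmulrn => /rat_sqr_eq/(congr1 absz).
rewrite abszM [X in _ = X -> _]abszM !abszX /=.
have := coprime_num_den r; move: `|numq r|%N `|denq r|%N => n m cop e.
have n1 : n = 1%N.
  apply: hc; rewrite -(@Gauss_dvdl _ _ (m ^ 2)) ?coprime_pexpl ?coprime_pexpr //.
  by rewrite -e dvdn_mull.
have m1 : m = 1%N.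
  apply: hd; rewrite -(@Gauss_dvdl _ _ (n ^ 2)).
    by rewrite e dvdn_mull.
  by rewrite coprime_pexpl ?coprime_pexpr // coprime_sym.
by move: e; rewrite n1 m1 !exp1n !muln1.
Qed.

Lemma square_free_prime (p : nat) : prime p -> square_free p.
Proof.
move=> pr m hm; have : (m %| p)%N by apply: dvdn_trans hm; rewrite dvdn_exp.
move/(primeP pr).2 => /orP[/eqP //|/eqP mp].
move: hm; rewrite mp => /dvdn_leq; have := prime_gt1 pr.
by move=> p1 /(_ (ltnW p1)); rewrite leqNgt -{1}(expn1 p) ltn_exp2l.
Qed.

(** * Units of Z[sqrt d] in algC *)

Lemma Zsqrt_elt_inj (d : nat) (a b a' b' : int) : nonsquare d%:Z ->
  Zsqrt_elt d a b = Zsqrt_elt d a' b' -> a = a' /\ b = b'.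
Proof.
rewrite /Zsqrt_elt => nsq e.
have e2 : (a - a')%:~R = (b' - b)%:~R * sqrtC d%:R :> algC.
  rewrite !rmorphB /= -[LHS](addrKA (b%:~R * sqrtC d%:R)) e; ring.
have [bb|nb] := eqVneq b' b; last first.
  case: (nsq ((a - a')%:~R / (b' - b)%:~R)).
  apply: (fmorph_inj (@ratr algC)); rewrite rmorphXn fmorph_div !rmorph_int.
  rewrite e2 mulrAC divff ?mul1r ?sqrtCK //.
  by rewrite intr_eq0 subr_eq0.
split=> //; apply/eqP; rewrite -subr_eq0 -(@intr_eq0 algC) e2 bb subrr.
by rewrite mul0r.
Qed.

Lemma Zsqrt_eltM (d : nat) (a b a' b' : int) :
  Zsqrt_elt d a b * Zsqrt_elt d a' b' =
  Zsqrt_elt d (a * a' + d%:Z * b * b') (a * b' + b * a').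
Proof.
rewrite /Zsqrt_elt; have := sqrtCK (d%:R : algC).
rewrite !(rmorphD, rmorphM) /= -pmulrn; move: (sqrtC d%:R) => r e.
by rewrite -e; ring.
Qed.

(** The norm of a + b sqrt D. Units are recognised below by its square being 1, which covers norms 1
    and -1 at once. *)
Definition normZ (D a b : int) : int := a ^+ 2 - D * b ^+ 2.

Lemma mulz_eq1_sqr (m n : int) : m * n = 1 -> m ^+ 2 = 1.
Proof.
move/(congr1 absz)/eqP; rewrite abszM muln_eq1 => /andP[/eqP m1 _].
by have [->|->] : m = 1 \/ m = -1 by lia.
Qed.

Lemma Zsqrt_unitP (d : nat) (a b : int) : nonsquare d%:Z ->
  Zsqrt_unit d (Zsqrt_elt d a b) <-> normZ d a b ^+ 2 = 1.
Proof.
move=> nsq; split.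
  move=> [_ [_ [a' [b' ->]]]]; rewrite Zsqrt_eltM => e.
  have [] := @Zsqrt_elt_inj d _ _ 1 0 nsq (etrans e _).
    by rewrite /Zsqrt_elt mul0r addr0.
  move=> e1 e2.
  have : normZ d a b * normZ d a' b' = 1.
    transitivity ((a * a' + d%:Z * b * b') ^+ 2 - d%:Z * (a * b' + b * a') ^+ 2).
      by rewrite /normZ; ring.
    by rewrite e1 e2; ring.
  exact: mulz_eq1_sqr.
move=> n1; split; first by exists a, b.
(* The inverse is the conjugate divided by the norm, and a norm of 1 or -1 is its own inverse. *)
exists (Zsqrt_elt d (normZ d a b * a) (- normZ d a b * b)).
  by do 2 eexists; reflexivity.
rewrite Zsqrt_eltM /Zsqrt_elt.
have -> : a * (normZ d a b * a) + d%:Z * b * (- normZ d a b * b) = 1.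
  by rewrite -n1 /normZ; ring.
have -> : a * (- normZ d a b * b) + b * (normZ d a b * a) = 0 by ring.
by rewrite mul0r addr0.
Qed.

Lemma sqrz_eq1 (m : int) : m ^+ 2 = 1 -> m = 1 \/ m = -1.
Proof. by move/eqP; rewrite sqrf_eq1 => /orP[]/eqP; [left|right]. Qed.

Lemma Zsqrt_unitM (d : nat) (x y : algC) :
  Zsqrt_unit d x -> Zsqrt_unit d y -> Zsqrt_unit d (x * y).
Proof.
have ZM u v : Zsqrt d u -> Zsqrt d v -> Zsqrt d (u * v).
  by move=> [a [b ->]] [a' [b' ->]]; rewrite Zsqrt_eltM; do 2 eexists.
move=> [Zx [x' Zx' xx']] [Zy [y' Zy' yy']]; split; first exact: ZM.
by exists (x' * y'); [exact: ZM | rewrite mulrACA xx' yy' mulr1].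
Qed.

Lemma Zsqrt_unitV (d : nat) (x : algC) : Zsqrt_unit d x -> Zsqrt_unit d x^-1.
Proof.
move=> [Zx [y Zy xy]]; have -> : x^-1 = y.
  have x0 : x != 0 by apply: contra_eq_neq xy => ->; rewrite mul0r eq_sym oner_eq0.
  by apply: (mulfI x0); rewrite xy divff.
by split=> //; exists x => //; rewrite mulrC.
Qed.

(** Some power of y exceeds x. Dividing x by y as long as x > 1 keeps it a unit at least 1, by
    minimality of y, so the descent ends at 1. *)
Lemma min_unit_powers (d : nat) (x y : algC) : min_unit_gt1 d y ->
  Zsqrt_unit d x -> 1 <= x -> exists k : nat, x = y ^+ k.
Proof.
move=> [uy y1 ymin] ux x1.
have y0 : 0 < y by apply: lt_trans y1.
(* A weak Bernoulli inequality, which makes the powers of y unbounded. *)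
have bern n : n%:R * (y - 1) <= y ^+ n.
  elim: n => [|n IH]; first by rewrite mul0r expr0 ler01.
  rewrite exprSr -natr1 mulrDl mul1r.
  have -> : y ^+ n * y = y ^+ n + y ^+ n * (y - 1) by ring.
  apply: lerD => //; apply: ler_peMl; first by rewrite subr_ge0 ltW.
  by rewrite exprn_ege1 // ltW.
have [n] : exists n : nat, x < y ^+ n.
  have y10 : 0 < y - 1 by rewrite subr_gt0.
  have q0 : 0 <= x / (y - 1) by rewrite divr_ge0 ?ltW // (lt_le_trans _ x1).
  exists (Num.Def.archi_bound (x / (y - 1))); apply: lt_le_trans (bern _).
  by rewrite -ltr_pdivrMr //; exact: archi_boundP.
elim: n x ux x1 => [|n IH] x ux x1 ltx.
  by move: ltx; rewrite expr0 => /(le_lt_trans x1); rewrite ltxx.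
have xr : x \is Num.real by rewrite ger0_real // (le_trans ler01).
have [x_gt1|x_le1] := real_ltP (real1 _) xr; last first.
  by exists 0%N; apply/eqP; rewrite expr0 eq_le x1 x_le1.
have [k e] : exists k, x / y = y ^+ k.
  apply: IH; first by apply: Zsqrt_unitM => //; exact: Zsqrt_unitV.
    by rewrite ler_pdivlMr // mul1r ymin.
  by rewrite ltr_pdivrMr // -exprSr.
by exists k.+1; rewrite exprSr -e divfK // gt_eqF.
Qed.

Lemma unit_power_coords (d : nat) (a b : int) (k : nat) : nonsquare d%:Z ->
  Zsqrt_unit d (Zsqrt_elt d a b) ->
  exists v w : int, Zsqrt_elt d a b ^+ k = Zsqrt_elt d v w /\
    normZ d v w ^+ 2 = 1.
Proof.
move=> nsq u; have : Zsqrt_unit d (Zsqrt_elt d a b ^+ k).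
  elim: k => [|k IH]; last by rewrite exprS; exact: Zsqrt_unitM.
  by rewrite expr0 -(divff (oner_neq0 algC)); apply: Zsqrt_unitM;
     [|apply: Zsqrt_unitV]; (split; first by exists 1, 0; rewrite /Zsqrt_elt mul0r addr0);
     exists 1; rewrite ?mulr1 //; exists 1, 0; rewrite /Zsqrt_elt mul0r addr0.
move=> uk; have [[v [w e]] _] := uk; exists v, w; split=> //.
by apply/(Zsqrt_unitP _ _ nsq); rewrite -e.
Qed.

(* In condition C the coefficient beta is odd, so that the minimal unit is not
   congruent to 1 modulo 2 and only its even powers are. *)
Lemma unit_mod2_is_square (d : nat) (a b p q : int) : nonsquare d%:Z ->
  min_unit_gt1 d (Zsqrt_elt d a b) -> odd `|b|%N ->
  normZ d p q ^+ 2 = 1 -> ~~ odd `|q|%N ->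
  exists e v w : int, [/\ e ^+ 2 = 1, normZ d v w ^+ 2 = 1,
    p = e * (v ^+ 2 + d%:Z * w ^+ 2) & q = e * (2 * v * w)].
Proof.
move=> nsq ymin bodd n1 qev.
(* Changing the sign of p or q is conjugation up to sign, which preserves the desired form; with
   both nonnegative, p + q sqrt d is at least 1 and hence a power of the minimal unit. *)
wlog p0 : p n1 / 0 <= p.
  move=> H; have [/H|p0] := lerP 0 p; first exact.
  have [||e [v [w [e2 nv pE qE]]]] := H (- p).
  - by rewrite /normZ sqrrN.
  - by rewrite oppr_ge0 ltW.
  by exists (- e), v, (- w); rewrite /normZ !sqrrN; split=> //;
    rewrite ?qE ?mulNr -?pE ?opprK //; ring.
wlog q0 : q n1 qev / 0 <= q.
  move=> H; have [/H|q0] := lerP 0 q; first exact.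
  have [||| e [v [w [e2 nv pE qE]]]] := H (- q).
  - by rewrite /normZ sqrrN.
  - by rewrite abszN.
  - by rewrite oppr_ge0 ltW.
  exists e, v, (- w); rewrite /normZ !sqrrN; split=> //.
  by rewrite -[q]opprK qE; ring.
have uy : Zsqrt_unit d (Zsqrt_elt d a b) by case: ymin.
have [k] : exists k, Zsqrt_elt d p q = Zsqrt_elt d a b ^+ k.
  apply: (min_unit_powers ymin); first exact/(Zsqrt_unitP _ _ nsq).
  rewrite /Zsqrt_elt.
  have r1 : 1 <= sqrtC d%:R :> algC.
    rewrite -[leLHS]sqrtC1 ler_sqrtC ?nnegrE ?ler01 ?ler0n // ler1n lt0n.
    by apply/eqP => d0; case: (nsq 0); rewrite d0 expr0n.
  have pq1 : 1 <= p + q.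
    have [p1|p1] := lerP 1 p; first by lia.
    have [q1|q1] := lerP 1 q; first by lia.
    have pE : p = 0 by lia.
    have qE : q = 0 by lia.
    by move: n1; rewrite /normZ pE qE; lia.
  apply: (@le_trans _ _ (p + q)%:~R); first by rewrite -[1]/(1%:~R) ler_int.
  by rewrite rmorphD /= lerD2l ler_peMr // ler0z.
have [v [w [yh nh]]] := unit_power_coords k./2 nsq uy.
rewrite -[k]odd_double_half -muln2 exprD exprM yh expr2 Zsqrt_eltM.
case: (odd k); rewrite ?expr1 ?expr0 ?Zsqrt_eltM ?mul1r;
  move=> /(Zsqrt_elt_inj nsq) [pE qE].
(* For an odd exponent, q is congruent modulo 2 to b (v^2 + d w^2), and v^2 + d w^2 has the parity
   of the norm of v + w sqrt d, which is odd. *)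
- suff: odd `|q|%N by rewrite (negbTE qev).
  rewrite qE.
  have [n nE] : exists n : int, v * v + d%:Z * w * w = 2 * n + 1.
    have [c cE] : exists c : int, normZ d v w = 2 * c + 1.
      by case: (sqrz_eq1 nh) => ->; [exists 0 | exists (-1)].
    exists (c + d%:Z * w ^+ 2).
    transitivity (normZ d v w + 2 * (d%:Z * w ^+ 2)); first by rewrite /normZ; ring.
    by rewrite cE; ring.
  rewrite nE; lia.
- by exists 1, v, w; split=> //; rewrite ?pE ?qE; ring.
Qed.

(** The conjugate of a unit z = a + b sqrt 2 > 1 is 1/z or -1/z, smaller than z in absolute value.
    Half the sum and half the difference of z and its conjugate are thus positive, so a and b are at
    least 1. *)
Lemma min_unit_Zsqrt2 : min_unit_gt1 2 (Zsqrt_elt 2 1 1).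
Proof.
have nsq : nonsquare 2%N by apply: nonsquare_mod4; left.
have r0 : 0 < sqrtC 2 :> algC by rewrite sqrtC_gt0 ltr0n.
split; first exact/(Zsqrt_unitP _ _ nsq).
  by rewrite /Zsqrt_elt mul1r ltrDl.
move=> z uz z1; have [[a [b zE]] _] := uz.
have z0 : 0 < z by apply: lt_trans z1.
have zi1 : z^-1 < 1 by rewrite invf_lt1.
have zi0 : 0 < z^-1 by rewrite invr_gt0.
move: uz; rewrite zE => /(Zsqrt_unitP _ _ nsq) nE.
have conjE : a%:~R - b%:~R * sqrtC 2 = (normZ 2 a b)%:~R * z^-1 :> algC.
  apply: (mulIf (lt0r_neq0 z0)); rewrite mulfVK ?lt0r_neq0 // zE /Zsqrt_elt.
  rewrite /normZ !(rmorphB, rmorphM) /= -[2%:~R]/(2 : algC).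
  by rewrite -[in RHS](sqrtCK 2); ring.
have [a0 b0] : 0 < a /\ 0 < b.
  suff [h1 h2] : 0 < a%:~R *+ 2 :> algC /\ 0 < (b%:~R * sqrtC 2) *+ 2 :> algC.
    by move: h1 h2; rewrite !pmulrn_lgt0 // pmulr_lgt0 // !ltr0z.
  have -> : a%:~R *+ 2 = z + (a%:~R - b%:~R * sqrtC 2) :> algC by rewrite zE /Zsqrt_elt; ring.
  have -> : (b%:~R * sqrtC 2) *+ 2 = z - (a%:~R - b%:~R * sqrtC 2) :> algC.
    by rewrite zE /Zsqrt_elt; ring.
  rewrite conjE; have [->|->] := sqrz_eq1 nE.
    by rewrite mul1r; split; [exact: addr_gt0 | rewrite subr_gt0 (lt_trans zi1)].
  by rewrite mulN1r opprK; split; [rewrite subr_gt0 (lt_trans zi1) | exact: addr_gt0].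
rewrite /Zsqrt_elt; apply: lerD; first by rewrite ler_int; lia.
by rewrite ler_pM2r // ler_int; lia.
Qed.

(** * Integers and units of Q(sqrt D) *)

Definition qelt (K : fieldExtType rat) (s : K) (r q : rat) : K :=
  in_alg K r + in_alg K q * s.

Definition normQ (D : int) (r q : rat) : rat := r ^+ 2 - D%:~R * q ^+ 2.

Lemma qelt_inj (D : int) (K : fieldExtType rat) (s : K) (r q r' q' : rat) :
  s ^+ 2 = D%:~R -> nonsquare D ->
  qelt s r q = qelt s r' q' -> r = r' /\ q = q'.
Proof.
move=> sD nsq e.
have e2 : in_alg K (r - r') = in_alg K (q' - q) * s.
  by rewrite !rmorphB -[LHS](addrKA (in_alg K q * s)) -/(qelt s r q) e /qelt; ring.
rewrite /= in e2; have [qq|nq] := eqVneq q' q; last first.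
  case: (nsq ((r - r') / (q' - q))).
  apply: (fmorph_inj (in_alg K)); rewrite rmorphXn fmorph_div /= e2 mulrAC divff.
    by rewrite mul1r sD -in_algE rmorph_int.
  by rewrite -in_algE fmorph_eq0 subr_eq0.
split=> //; apply/eqP; rewrite -subr_eq0 -(fmorph_eq0 (in_alg K)) /= e2 qq subrr.
by rewrite scale0r mul0r.
Qed.

Lemma qeltM (D : int) (K : fieldExtType rat) (s : K) (r q r' q' : rat) :
  s ^+ 2 = D%:~R ->
  qelt s r q * qelt s r' q' = qelt s (r * r' + D%:~R * q * q') (r * q' + q * r').
Proof.
move=> sD; rewrite /qelt !(rmorphD, rmorphM) rmorph_int -sD; ring.
Qed.

Lemma normQ_mul (D : int) (K : fieldExtType rat) (s : K)
    (r q r' q' r'' q'' : rat) :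
  s ^+ 2 = D%:~R -> nonsquare D ->
  qelt s r q * qelt s r' q' = qelt s r'' q'' ->
  normQ D r q * normQ D r' q' = normQ D r'' q''.
Proof.
move=> sD nsq; rewrite (qeltM _ _ _ _ sD) => /(qelt_inj sD nsq) [<- <-].
rewrite /normQ; ring.
Qed.

(** Elements of Q(s) are polynomials in s, and s^2 = D folds the Horner step (r + q s) s + c into (D
    q + c) + r s. *)
Lemma qeltP (D : int) (K : fieldExtType rat) (s : K) : is_Q_sqrt D s ->
  forall x : K, exists r q : rat, x = qelt s r q.
Proof.
move=> [sD full] x.
have /Fadjoin_polyP [p /polyOver1P [p' ->] ->] : x \in <<1; s>>%VS.
  by rewrite full memvf.
elim/poly_ind: p' {p x} => [|p c [r [q IH]]].
  by exists 0, 0; rewrite rmorph0 horner0 /qelt rmorph0 mul0r addr0.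
exists (D%:~R * q + c), r.
rewrite rmorphD rmorphM /= map_polyX map_polyC !hornerE IH /qelt.
rewrite rmorphD rmorphM rmorph_int -sD /=; ring.
Qed.

(** If the square of r + q s is rational, its irrational part 2 r q vanishes. *)
Lemma sqr_int_cases (D : int) (K : fieldExtType rat) (s : K) (x : K) (c : int) :
  is_Q_sqrt D s -> nonsquare D -> x ^+ 2 = c%:~R ->
  exists r : rat, r ^+ 2 = c%:~R \/ D%:~R * r ^+ 2 = c%:~R.
Proof.
move=> Ks nsq; have [sD _] := Ks; have [r [q ->]] := qeltP Ks x.
have -> : c%:~R = qelt s c%:~R 0 by rewrite /qelt rmorph_int rmorph0 mul0r addr0.
rewrite expr2 (qeltM _ _ _ _ sD) => /(qelt_inj sD nsq) [e].
have -> : r * q + q * r = 2 * (r * q) by ring.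
move=> /eqP; rewrite mulf_eq0 /= mulf_eq0 => /orP[] /eqP h.
  by exists q; right; rewrite -e h; ring.
by exists r; left; rewrite -e h; ring.
Qed.

(* By Gauss' lemma the monic minimal polynomial of an algebraic integer has
   integer coefficients. *)
Lemma monic_dvd_int (p : {poly rat}) (g : {poly int}) :
  p \is monic -> g \is monic -> p %| map_poly intr g ->
  forall i, p`_i \is a Num.int.
Proof.
move=> mp mg /dvdpP_rat_int [p1 [a a0 pE] [r gE]] i.
(* The leading coefficient of [p1] divides that of [g], so it is 1 or -1; as [p] is monic, the
   rational factor [a] is then an integer too. *)
have l1 : lead_coef p1 ^+ 2 = 1.
  by apply: (@mulz_eq1_sqr _ (lead_coef r)); rewrite -lead_coefM -gE (monicP mg).
have aE : a * (lead_coef p1)%:~R = 1.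
  by rewrite -[RHS](monicP mp) pE lead_coefZ lead_coef_map_inj //; last exact: intr_inj.
have aint : a \is a Num.int.
  have -> : a = a * (lead_coef p1 ^+ 2)%:~R by rewrite l1 mulr1.
  by rewrite expr2 intrM mulrA aE mul1r intr_int.
by rewrite pE coefZ coef_map rpredM // intr_int.
Qed.

(** The coefficients of the minimal polynomial, X^2 - 2 r X + N for q nonzero and X - r for q = 0,
    are integers. *)
Lemma integral_qelt (D : int) (K : fieldExtType rat) (s : K) (r q : rat) :
  s ^+ 2 = D%:~R -> nonsquare D -> ring_of_integers K (qelt s r q) ->
  (2 * r \is a Num.int) /\ (normQ D r q \is a Num.int).
Proof.
move=> sD nsq [g mg gx].
have sz2 c1 c0 : size ('X^2 + c1 *: 'X + c0%:P : {poly rat}) = 3.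
  rewrite -addrA size_polyDl size_polyXn // ltnS.
  by rewrite (leq_trans (size_polyD _ _)) // geq_max size_polyC
    (leq_trans (size_scale_leq _ _)) ?size_polyX //; case: (c0 != 0).
have mon c1 c0 : ('X^2 + c1 *: 'X + c0%:P : {poly rat}) \is monic.
  rewrite monicE lead_coefE sz2 !coefD coefXn coefZ coefX coefC /=.
  by rewrite mulr0 !addr0.
have eG : map_poly (in_alg K) (map_poly intr g) = map_poly intr g.
  by rewrite -map_poly_comp; apply: eq_map_poly => c; rewrite /= -in_algE rmorph_int.
have [q0|qn0] := eqVneq q 0.
  have /(monic_dvd_int (monicXsubC _) mg)/(_ 0) : 'X - r%:P %| map_poly intr g.
    rewrite dvdp_XsubCl /root -(fmorph_eq0 (in_alg K)) -horner_map eG.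
    by move: gx; rewrite /qelt q0 rmorph0 mul0r addr0.
  rewrite coefB coefX coefC sub0r rpredN => rint.
  by rewrite /normQ q0 expr0n mulr0 subr0 rpredX // rpredM // (natr_int _ 2).
pose m : {poly rat} := 'X^2 + (- (2 * r)) *: 'X + (normQ D r q)%:P.
suff dvd : m %| map_poly intr g.
  have h := monic_dvd_int (mon _ _) mg dvd.
  split; last by have := h 0; rewrite !coefD coefXn coefZ coefX coefC /= mulr0 !add0r.
  have := h 1; rewrite !coefD coefXn coefZ coefX coefC /= mulr1 add0r addr0.
  by rewrite rpredN.
have m0 : m != 0 by rewrite -size_poly_eq0 sz2.
(* The remainder has degree at most 1 and vanishes at r + q s with q nonzero, hence is zero. *)
pose R : {poly rat} := map_poly intr g %% m.
have szR : (size R <= 2)%N by move: (ltn_modp (map_poly intr g) m); rewrite m0 sz2.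
have RE : R = (R`_1) *: 'X + (R`_0)%:P.
  apply/polyP => -[|[|i]]; rewrite coefD coefZ coefX coefC /=.
  - by rewrite mulr0 add0r.
  - by rewrite mulr1 addr0.
  - by rewrite mulr0 addr0 nth_default // (leq_trans szR).
have ev c1 c0 x : (map_poly (in_alg K) ('X^2 + c1 *: 'X + c0%:P)).[x]
    = x ^+ 2 + in_alg K c1 * x + in_alg K c0.
  by rewrite !rmorphD /= map_polyXn map_polyZ map_polyX map_polyC !hornerE.
have mx : (map_poly (in_alg K) m).[qelt s r q] = 0.
  rewrite ev expr2 (qeltM _ _ _ _ sD) /qelt /normQ.
  by rewrite !(rmorphD, rmorphM, rmorphN, rmorphB) rmorph_int -sD; ring.
have : (map_poly (in_alg K) R).[qelt s r q] = 0.
  move: gx; rewrite /root -eG (divp_eq (map_poly intr g) m) -/R.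
  by rewrite rmorphD rmorphM /= hornerD hornerM mx mulr0 add0r => /eqP.
rewrite RE rmorphD /= map_polyZ map_polyX map_polyC !hornerE => e.
have /(qelt_inj sD nsq) [] : qelt s (R`_1 * r + R`_0) (R`_1 * q) = qelt s 0 0.
  rewrite {2}/qelt rmorph0 mul0r addr0 -e /qelt rmorphD !rmorphM; ring.
move=> e0 /eqP; rewrite mulf_eq0 (negbTE qn0) orbF => /eqP R1.
move: e0; rewrite R1 mul0r add0r => R0.
by rewrite /dvdp -/R RE R1 R0 scale0r add0r polyC0.
Qed.

Lemma square_free_int (d : nat) (r : rat) :
  square_free d -> d%:R * r ^+ 2 \is a Num.int -> r \is a Num.int.
Proof.
move=> sqf /intrP [c]; rewrite pmulrn => /rat_sqr_eq/(congr1 absz).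
rewrite abszM [X in _ = X -> _]abszM !abszX /= => e.
have cop := coprime_num_den r.
have n1 : `|denq r|%N = 1%N.
  apply: sqf; rewrite -(@Gauss_dvdl _ _ (`|numq r| ^ 2)).
    by rewrite e dvdn_mull.
  by rewrite coprime_pexpl ?coprime_pexpr // coprime_sym.
by rewrite Qint_def; apply/eqP; have := denq_gt0 r; lia.
Qed.

Definition zelt (K : fieldExtType rat) (s : K) (p q : int) : K :=
  p%:~R + q%:~R * s.

Lemma zeltE (K : fieldExtType rat) (s : K) (p q : int) :
  zelt s p q = qelt s p%:~R q%:~R.
Proof. by rewrite /qelt !rmorph_int. Qed.

Lemma zelt_inj (D : int) (K : fieldExtType rat) (s : K) (p q p' q' : int) :
  s ^+ 2 = D%:~R -> nonsquare D ->
  zelt s p q = zelt s p' q' -> p = p' /\ q = q'.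
Proof.
move=> sD nsq; rewrite !zeltE => /(qelt_inj sD nsq) [e1 e2].
by split; apply: (@intr_inj rat).
Qed.

Lemma zeltM (D : int) (K : fieldExtType rat) (s : K) (p q p' q' : int) :
  s ^+ 2 = D%:~R ->
  zelt s p q * zelt s p' q' = zelt s (p * p' + D * q * q') (p * q' + q * p').
Proof. by move=> sD; rewrite /zelt !(rmorphD, rmorphM) /= -sD; ring. Qed.

Lemma normZ_mul (D : int) (K : fieldExtType rat) (s : K)
    (a b c e a' b' c' e' : int) :
  s ^+ 2 = D%:~R -> nonsquare D ->
  zelt s a b * zelt s c e = zelt s a' b' * zelt s c' e' ->
  normZ D a b * normZ D c e = normZ D a' b' * normZ D c' e'.
Proof.
move=> sD nsq; rewrite !(zeltM _ _ _ _ sD) => /(zelt_inj sD nsq) [h1 h2].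
transitivity (normZ D (a * c + D * b * e) (a * e + b * c)).
  by rewrite /normZ; ring.
by rewrite h1 h2 /normZ; ring.
Qed.

(** With integral trace m = 2 r and norm N, d (2 q)^2 = m^2 - 4 N makes k = 2 q an integer since d
    is square-free; then m^2 = d k^2 modulo 4 forces m and k to be even. *)
Lemma integral_zelt (d : nat) (K : fieldExtType rat) (s x : K) :
  square_free d -> (d %% 4 = 2 \/ d %% 4 = 3)%N ->
  is_Q_sqrt d%:Z s -> ring_of_integers K x ->
  exists p q : int, x = zelt s p q.
Proof.
move=> sqf hd Ks; have [sD _] := Ks; have nsq := nonsquare_mod4 hd.
have [r [q ->]] := qeltP Ks x.
move=> /(integral_qelt sD nsq) [/intrP [m mE] /intrP [N NE]].
have q2E : d%:R * (2 * q) ^+ 2 = (m ^+ 2 - 4 * N)%:~R :> rat.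
  rewrite rmorphB rmorphXn rmorphM /= -mE -NE /normQ -[(Posz d)%:~R]/(d%:R); ring.
have /intrP [k kE] : 2 * q \is a Num.int.
  by apply: square_free_int sqf _; rewrite q2E intr_int.
have e : d%:Z * k ^+ 2 = m ^+ 2 - 4 * N.
  apply: (@intr_inj rat); rewrite -q2E kE.
  by rewrite rmorphM rmorphXn.
have [m' [k' [m'E k'E]]] : exists m' k' : int, m = 2 * m' /\ k = 2 * k'.
  exists (divz m 2), (divz k 2).
  have := divn_eq d 4; have := divz_eq m 2; have := divz_eq k 2.
  have := modz_ge0 m (isT : 2 != 0 :> int); have := modz_ge0 k (isT : 2 != 0 :> int).
  have := ltz_pmod m (isT : 0 < 2 :> int); have := ltz_pmod k (isT : 0 < 2 :> int).
  move: (divz m 2) (divz k 2) (modz m 2) (modz k 2) (d %/ 4)%N (d %% 4)%N hd e.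
  move=> m2 k2 m0 k0 d2 d0 hd e h1 h2 h3 h4 h5 h6 h7.
  have [mE0|mE0] : m0 = 0 \/ m0 = 1 by lia.
  - have [kE0|kE0] : k0 = 0 \/ k0 = 1 by lia.
      by subst; split; ring.
    by subst; nia.
  - have [kE0|kE0] : k0 = 0 \/ k0 = 1 by lia.
      by subst; nia.
    by subst; nia.
exists m', k'; rewrite zeltE.
have two0 : 2 != 0 :> rat by [].
congr qelt; apply: (mulfI two0).
  by rewrite mE m'E rmorphM.
by rewrite kE k'E rmorphM.
Qed.

(** * Solutions of the equation *)

(** Only the second coordinate of a solution is assumed integral; the first is a root of the monic
    X^3 - t^2 X + 1, whose coefficients are integral. *)
Lemma root_integral (K : fieldExtType rat) (x t : K) :
  ring_of_integers K t -> x ^+ 3 - t ^+ 2 * x + 1 = 0 -> ring_of_integers K x.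
Proof.
move=> it e.
pose p : {poly K} := 'X^3 - t ^+ 2 *: 'X + 1%:P.
have szp : size p = 4.
  rewrite /p -addrA size_polyDl size_polyXn // ltnS.
  rewrite (leq_trans (size_polyD _ _)) // geq_max size_polyN size_polyC.
  by rewrite (leq_trans (size_scale_leq _ _)) ?size_polyX //; case: (_ != 0).
apply: (@integral_root_monic _ _ (intr : {rmorphism int -> K}) x p).
- by rewrite monicE lead_coefE szp /p !coefD coefN coefXn coefZ coefX coefC /= mulr0 subr0 addr0.
- by rewrite /root /p !hornerE e.
- apply/integral_poly => i; rewrite /p !coefD coefN coefXn coefZ coefX coefC.
  apply: integral_add; last by case: (i == 0)%N; [exact: integral1 | exact: integral0].
  apply: integral_sub; first by case: (i == 3)%N; [exact: integral1 | exact: integral0].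
  apply: integral_mul; first by rewrite expr2; exact: integral_mul.
  by case: (i == 1)%N; [exact: integral1 | exact: integral0].
Qed.

Lemma ring_of_integersD (K : fieldExtType rat) (x y : K) :
  ring_of_integers K x -> ring_of_integers K y -> ring_of_integers K (x + y).
Proof. exact: (@integral_add _ _ (intr : {rmorphism int -> K})). Qed.

Lemma ring_of_integersB (K : fieldExtType rat) (x y : K) :
  ring_of_integers K x -> ring_of_integers K y -> ring_of_integers K (x - y).
Proof. exact: (@integral_sub _ _ (intr : {rmorphism int -> K})). Qed.

Lemma ring_of_integersM (K : fieldExtType rat) (x y : K) :
  ring_of_integers K x -> ring_of_integers K y -> ring_of_integers K (x * y).
Proof. exact: (@integral_mul _ _ (intr : {rmorphism int -> K})). Qed.

(** The norms of an integral element and of its integral inverse are integers with product 1. *)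
Lemma unit_normQ (D : int) (K : fieldExtType rat) (s y : K) (r q : rat) :
  is_Q_sqrt D s -> nonsquare D ->
  ring_of_integers K (qelt s r q) -> ring_of_integers K y ->
  qelt s r q * y = 1 -> normQ D r q ^+ 2 = 1.
Proof.
move=> Ks nsq ix; have [sD _] := Ks; have [r' [q' ->]] := qeltP Ks y => iy xy.
have /intrP [m mE] := (integral_qelt sD nsq ix).2.
have /intrP [n nE] := (integral_qelt sD nsq iy).2.
have e1 : qelt s 1 0 = 1 by rewrite /qelt rmorph1 rmorph0 mul0r addr0.
have := normQ_mul sD nsq (etrans xy (esym e1)).
rewrite {3}/normQ expr1n expr0n mulr0 subr0 mE nE -intrM.
by move=> /(@intr_inj rat _ 1) /mulz_eq1_sqr e; rewrite -rmorphXn /= e.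
Qed.

Lemma unit_normZ (D : int) (K : fieldExtType rat) (s y : K) (p q : int) :
  is_Q_sqrt D s -> nonsquare D ->
  ring_of_integers K (zelt s p q) -> ring_of_integers K y ->
  zelt s p q * y = 1 -> normZ D p q ^+ 2 = 1.
Proof.
rewrite zeltE => Ks nsq ix iy xy; apply: (@intr_inj rat).
rewrite rmorphXn -[RHS](unit_normQ Ks nsq ix iy xy) /normZ /normQ.
by rewrite rmorphB rmorphXn rmorphM rmorphXn.
Qed.

(** * Solutions over a real quadratic field *)

Lemma root_real (d : nat) (K : fieldExtType rat) (s u t : K) (a b : int) :
  square_free d -> (d %% 4 = 2 \/ d %% 4 = 3)%N -> is_Q_sqrt d%:Z s ->
  min_unit_gt1 d (Zsqrt_elt d a b) -> odd `|b|%N ->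
  ring_of_integers K t -> u ^+ 3 - t ^+ 2 * u + 1 = 0 ->
  t = 0 \/ d = 2 /\ u ^+ 3 = 1.
Proof.
move=> sqf hd Ks ymin bodd it e.
have [sD _] := Ks; have nsq := nonsquare_mod4 hd.
have iu := root_integral it e.
have uab : u * ((t + u) * (t - u)) = 1.
  by apply/eqP; rewrite -subr_eq0 -oppr_eq0 -e; apply/eqP; ring.
have ia := ring_of_integersD it iu; have ib := ring_of_integersB it iu.
have [p [q uE]] := integral_zelt sqf hd Ks iu.
have [k [l tE]] := integral_zelt sqf hd Ks it.
have aE : t + u = zelt s (k + p) (l + q).
  by rewrite tE uE /zelt !rmorphD /=; ring.
have bE : t - u = zelt s (k - p) (l - q).
  by rewrite tE uE /zelt !rmorphB /=; ring.
have nu : normZ d p q ^+ 2 = 1.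
  apply: (unit_normZ Ks nsq _ (ring_of_integersM ia ib)); rewrite -uE //.
have na : normZ d (k + p) (l + q) ^+ 2 = 1.
  apply: (unit_normZ Ks nsq _ (ring_of_integersM iu ib)); rewrite -aE //.
  by rewrite mulrCA.
have nb : normZ d (k - p) (l - q) ^+ 2 = 1.
  apply: (unit_normZ Ks nsq _ (ring_of_integersM iu ia)); rewrite -bE //.
  by rewrite mulrC -mulrA.
set nB := normZ d (k - p) (l - q) in nb.
(* [P + Q s] is the unit (t + u) / (t - u), computed with the conjugate of t - u; its irrational
   part is visibly even. *)
pose P := nB * ((k + p) * (k - p) - d%:Z * (l + q) * (l - q)).
pose Q := nB * 2 * (k * q - p * l).
have cE : zelt s P Q * (t - u) = t + u.
  transitivity ((nB ^+ 2)%:~R * (t + u)); last by rewrite nb mul1r.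
  rewrite bE aE /zelt /P /Q /nB /normZ.
  rewrite !(rmorphB, rmorphD, rmorphM) /= -sD; ring.
have nc : normZ d P Q ^+ 2 = 1.
  move: cE; rewrite bE aE -[RHS]mulr1 -(_ : zelt s 1 0 = 1); last first.
    by rewrite /zelt mul0r addr0.
  move=> /(normZ_mul sD nsq) h.
  have := congr1 (fun x => x ^+ 2) h; rewrite /= !exprMn na -/nB nb !mulr1 => ->.
  by rewrite /normZ; ring.
have Qeven : ~~ odd `|Q|%N by rewrite /Q -mulrA mulrCA abszM oddM.
have [e0 [v [w [e2 nv PE QE]]]] := unit_mod2_is_square nsq ymin bodd nc Qeven.
set n := normZ d v w in nv.
have VV : zelt s v w * zelt s v (- w) = n%:~R.
  by rewrite /zelt /n /normZ !(rmorphB, rmorphM, rmorphN) /= -sD; ring.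
have cE2 : zelt s P Q = e0%:~R * zelt s v w ^+ 2.
  by rewrite PE QE /zelt !(rmorphD, rmorphM) /= -sD; ring.
(* Multiply 2 u = (e0 V^2 - 1) (t - u) by the conjugate V' and use V V' = n: the first factor is e0
   n V - V'. *)
have key : zelt s ((e0 * n - 1) * v) ((e0 * n + 1) * w) * (t - u) = 2 * (u * zelt s v (- w)).
  have -> : 2 * (u * zelt s v (- w)) = (zelt s P Q * (t - u) - (t - u)) * zelt s v (- w).
    by rewrite cE; ring.
  transitivity ((e0%:~R * zelt s v w * (zelt s v w * zelt s v (- w)) - zelt s v (- w)) * (t - u)).
    by rewrite VV /zelt !(rmorphB, rmorphD, rmorphM, rmorphN) /=; ring.
  by rewrite cE2; ring.
have two0 : 2 != 0 :> K by rewrite -(rmorph_nat (in_alg K)) fmorph_eq0.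
have nV' : normZ d v (- w) = n by rewrite /normZ sqrrN.
have en2 : (e0 * n) ^+ 2 = 1 by rewrite exprMn e2 nv.
have [en|en] := sqrz_eq1 en2; rewrite en in key.
  (* Case e0 = n: here w s (t - u) = u V', and taking norms gives d^2 w^4 = 1, so d = 1, against its
     residue modulo 4. *)
  have : zelt s 0 w * zelt s (k - p) (l - q) = u * zelt s v (- w).
    by apply: (mulfI two0); rewrite -key -bE /zelt !rmorphM /=; ring.
  rewrite uE => /(normZ_mul sD nsq) /(congr1 (fun x => x ^+ 2)).
  rewrite /= !exprMn nV' nu nv -/nB nb !mulr1 /normZ => h.
  have /mulz_eq1_sqr d1 : d%:Z * (d%:Z * w ^+ 4) = 1 by rewrite -h; ring.
  by case: (sqrz_eq1 d1) => // -[dE]; move: hd; rewrite dE; case.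
(* Case e0 = -n: taking norms gives v^4 = 1. *)
have h : zelt s (- v) 0 * (t - u) = u * zelt s v (- w).
  by apply: (mulfI two0); rewrite -key /zelt !rmorphM /= !rmorphN /=; ring.
have v4 : (v ^+ 2) ^+ 2 = 1.
  move: h; rewrite bE uE => /(normZ_mul sD nsq) /(congr1 (fun x => x ^+ 2)).
  by rewrite /= !exprMn nV' nu nv -/nB nb !mulr1 /normZ => <-; ring.
have v2 : v ^+ 2 = 1 by case: (sqrz_eq1 v4) => // h1; have := sqr_ge0 v; rewrite h1.
have nE : n = 1 - d%:Z * w ^+ 2 by rewrite /n /normZ v2.
have [n1|n1] := sqrz_eq1 nv.
  (* For n = 1, w = 0 and e0 = -1, so t + u = -(t - u). *)
  left; have w0 : w = 0.
    have /eqP : d%:Z * w ^+ 2 = 0 by rewrite -[LHS](subKr 1) -nE n1.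
    rewrite mulf_eq0 sqrf_eq0 => /orP[] /eqP // [d0].
    by move: hd; rewrite d0; case.
  have eN : e0 = -1 by move: en; rewrite n1 mulr1.
  move: cE; rewrite cE2 w0 eN /zelt mul0r addr0 -rmorphXn v2 mulr1 => ce.
  apply: (mulfI two0); rewrite mulr0.
  transitivity ((t + u) + (t - u)); first by ring.
  by rewrite -ce; ring.
right; have dw : d%:Z * w ^+ 2 = 2 by rewrite -[LHS](subKr 1) -nE n1.
have d2 : d = 2%N.
  apply: (@square_free_eq 2 d w%:~R (square_free_prime _) sqf) => //.
  have := congr1 (fun x : int => x%:~R : rat) dw.
  by rewrite /= rmorphM rmorphXn.
split=> //.
have e1 : e0 = 1 by move: en; rewrite n1 mulrN1 => /oppr_inj.
have v2K : v%:~R ^+ 2 = 1 :> K by rewrite -rmorphXn v2.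
have uE2 : u = v%:~R * zelt s v w * (t - u).
  have hu : - u = zelt s (- v) 0 * (t - u) * zelt s v w.
    by rewrite h -mulrA [_ * zelt s v w]mulrC VV n1 /=; ring.
  by rewrite -[LHS]opprK [in LHS]hu /zelt rmorphN /=; ring.
(* Substitute t + u = V^2 (t - u) in u (t + u) (t - u) = 1, and use u = v V (t - u). *)
have : u ^+ 3 * v%:~R = v%:~R ^+ 3.
  transitivity (v%:~R ^+ 3 * (u * ((t + u) * (t - u)))); last by rewrite uab mulr1.
  rewrite -cE cE2 e1 mul1r.
  transitivity (v%:~R ^+ 2 * v%:~R * u * (v%:~R * zelt s v w * (t - u)) ^+ 2 ).
    by rewrite -uE2 v2K; ring.
  rewrite v2K; transitivity (v%:~R ^+ 2 * v%:~R * u * zelt s v w ^+ 2 * (t - u) ^+ 2).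
    by ring.
  by ring.
have v0 : v%:~R != 0 :> K.
  by apply: contra_eq_neq v2K => ->; rewrite expr0n eq_sym oner_eq0.
by move=> h3; apply: (mulIf v0); rewrite h3 exprSr v2K.
Qed.

(** * Solutions over an imaginary quadratic field *)

Lemma qelt_sqr (D : int) (K : fieldExtType rat) (s : K) (r q : rat) :
  s ^+ 2 = D%:~R ->
  qelt s r q ^+ 2 = in_alg K (2 * r) * qelt s r q - in_alg K (normQ D r q).
Proof.
move=> sD; rewrite expr2 (qeltM _ _ _ _ sD) /qelt /normQ.
by rewrite !(rmorphD, rmorphM, rmorphN, rmorphB) rmorph_int -sD; ring.
Qed.

(** The unit u has norm 1 and an integral trace m with m^2 <= 4. Each trace leads to u^3 = -1, where
    t = 0, or to 2 being a square where it is not. *)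
Lemma root_imaginary (d : nat) (K : fieldExtType rat) (s u t : K) :
  (0 < d)%N -> square_free d -> is_Q_sqrt (- d%:Z) s ->
  ring_of_integers K t -> u ^+ 3 - t ^+ 2 * u + 1 = 0 -> t = 0.
Proof.
move=> d0 sqf Ks it e.
have [sD _] := Ks; have nsq : nonsquare (- d%:Z) by apply: nonsquare_neg; lia.
have nsq2 : nonsquare 2%N by apply: nonsquare_mod4; left.
have dQ : 0 < d%:R :> rat by rewrite ltr0n.
have dE : (- d%:Z)%:~R = - d%:R :> rat by rewrite rmorphN.
have iu := root_integral it e.
have uab : u * (t ^+ 2 - u ^+ 2) = 1.
  by apply/eqP; rewrite -subr_eq0 -oppr_eq0 -e; apply/eqP; ring.
have u0 : u != 0 by apply: contra_eq_neq uab => ->; rewrite mul0r eq_sym oner_eq0.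
have cubeN1 : u ^+ 3 = -1 -> t = 0.
  move=> u3; move/eqP: e; rewrite u3 addrAC addNr sub0r oppr_eq0 mulf_eq0.
  by rewrite (negbTE u0) orbF sqrf_eq0 => /eqP.
(* Here t^2 u = 2, so (t u^2)^2 = 2, although 2 is not a square in an imaginary quadratic field. *)
have cube1 : u ^+ 3 <> 1.
  move=> u3; have : (t * u ^+ 2) ^+ 2 = 2%:~R.
    transitivity (u ^+ 3 * (u ^+ 3 + 1 - (u ^+ 3 - t ^+ 2 * u + 1))); first by ring.
    by rewrite e u3; ring.
  move=> /(sqr_int_cases Ks nsq) [r [/nsq2 //|]]; rewrite dE => h.
  have : 0 <= d%:R * r ^+ 2 := mulr_ge0 (ltW dQ) (sqr_ge0 r).
  by rewrite -oppr_le0 -mulNr h.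
have [r [q uE]] := qeltP Ks u.
have N1 : r ^+ 2 + d%:R * q ^+ 2 = 1.
  have : normQ (- d%:Z) r q ^+ 2 = 1.
    rewrite uE in iu uab; apply: (unit_normQ Ks nsq iu _ uab).
    by apply: ring_of_integersB; rewrite expr2; apply: ring_of_integersM.
  rewrite /normQ dE mulNr opprK => /eqP; rewrite sqrf_eq1 => /orP[/eqP //|/eqP h].
  by have := addr_ge0 (sqr_ge0 r) (mulr_ge0 (ltW dQ) (sqr_ge0 q)); rewrite h.
have /intrP [m mE] : 2 * r \is a Num.int by rewrite uE in iu; case: (integral_qelt sD nsq iu).
have u2 : u ^+ 2 = m%:~R * u - 1.
  rewrite uE (qelt_sqr _ _ sD) mE rmorph_int /normQ dE.
  by rewrite mulNr opprK N1 rmorph1.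
have m4 : m ^+ 2 <= 4.
  rewrite -(ler_int rat) rmorphXn /= -mE exprMn (_ : 4%:~R = 2 ^+ 2 * 1) // ler_pM2l //.
  by rewrite -N1 lerDl (mulr_ge0 (ltW dQ) (sqr_ge0 q)).
have u3 : u ^+ 3 = (m ^+ 2 - 1)%:~R * u - m%:~R.
  by rewrite exprS u2 mulrBr mulrCA -expr2 u2 rmorphB rmorphXn /=; ring.
have [m0|[m1|m2]] : m = 0 \/ m ^+ 2 = 1 \/ m ^+ 2 = 4.
  have : -2 <= m <= 2 by nia.
  move=> mb; have : m = 0 \/ m = 1 \/ m = -1 \/ m = 2 \/ m = -2 by lia.
  by case=> [|[|[|[|]]]] ->; [left | right; left | right; left | right; right | right; right].
(* Trace 0: u^2 = -1 gives t^2 = -1 - u, of norm 2, so the rational norm of t would have square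
   2. *)
- have r0 : r = 0 by move: mE; rewrite m0 => /eqP; rewrite mulf_eq0 => /orP[] /eqP.
  have : t ^+ 2 = qelt s (-1) (- q).
    apply: (mulIf u0); transitivity (u ^+ 3 + 1 - (u ^+ 3 - t ^+ 2 * u + 1)); first by ring.
    rewrite e u3 m0; transitivity (- u - (0%:~R * u - 1)); first by ring.
    rewrite -[0%:~R]/(0 : int)%:~R -{1}m0 -u2; transitivity (- (1 + u) * u); first by ring.
    by rewrite {1}uE r0 /qelt !rmorphN rmorph0 rmorph1; ring.
  have [k [l ->]] := qeltP Ks t; rewrite expr2 => /(normQ_mul sD nsq).
  rewrite -expr2 => h; case: (nsq2 (normQ (- d%:Z) k l)); rewrite h /normQ dE.
  by move: N1; rewrite r0 expr0n add0r !sqrrN mulNr opprK expr1n => ->.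
(* Trace 1 or -1: u^3 = -m. *)
- rewrite m1 subrr mul0r sub0r in u3.
  have [mE1|mE1] := sqrz_eq1 m1; rewrite mE1 in u3; first exact: cubeN1.
  by case: cube1; rewrite u3 rmorphN opprK.
(* Trace 2 or -2: u is 1 or -1. *)
- have r2 : r ^+ 2 = 1.
    apply: (@mulfI _ 4) => //; rewrite mulr1 -[RHS]/(4%:~R) -m2 rmorphXn /= -mE; ring.
  have q0 : q = 0.
    move: N1; rewrite r2 => /eqP; rewrite -subr_eq0 addrAC subrr add0r mulf_eq0.
    by rewrite gt_eqF //= sqrf_eq0 => /eqP.
  have := r2 => /eqP; rewrite sqrf_eq1 => /orP[] /eqP r1; rewrite r1 q0 in uE.
    by case: cube1; rewrite uE /qelt rmorph1 rmorph0 mul0r addr0 expr1n.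
  by apply: cubeN1; rewrite uE /qelt rmorphN1 rmorph0 mul0r addr0; ring.
Qed.

(** As 4 (u^3 + 1) = (u + 1) ((2 u - 1)^2 + 3), any other root would make -3 a square in K. *)
Lemma cubeN1_eqN1 (D : int) (K : fieldExtType rat) (s u : K) :
  is_Q_sqrt D s -> nonsquare D -> (forall r : rat, D%:~R * r ^+ 2 <> -3) ->
  u ^+ 3 = -1 -> u = -1.
Proof.
move=> Ks nsq h3 u3.
have /eqP : (u + 1) * ((2 * u - 1) ^+ 2 + 3) = 0.
  by transitivity (4 * (u ^+ 3 + 1)); [ring | rewrite u3 addNr mulr0].
rewrite mulf_eq0 !addr_eq0 => /orP[] /eqP // h.
have hz : (2 * u - 1) ^+ 2 = (-3)%:~R by rewrite h.
have [r [h'|/h3 //]] := sqr_int_cases Ks nsq hz.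
by have := sqr_ge0 r; rewrite h'.
Qed.

Lemma cube1_eq1 (D : int) (K : fieldExtType rat) (s u : K) :
  is_Q_sqrt D s -> nonsquare D -> (forall r : rat, D%:~R * r ^+ 2 <> -3) ->
  u ^+ 3 = 1 -> u = 1.
Proof.
move=> Ks nsq h3 u3; apply: oppr_inj; apply: (cubeN1_eqN1 Ks nsq h3).
by rewrite exprNn u3; ring.
Qed.

(** * The four families of fields *)

Theorem theorem1p1 (d : nat) (d_gt0 : (0 < d)%N) (d_sqf : square_free d)
    (D : int) (D_d : D = d%:Z \/ D = - d%:Z)
    (K : fieldExtType rat) (s : K) (K_s : is_Q_sqrt D s) :
  [/\ D = 2 ->
        solutions K = [set (-1, 0); (1, s); (1, - s)],
      D = d%:Z -> d <> 2%N -> condition_C d ->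
        solutions K = [set (-1, 0)],
      D = - d%:Z -> d <> 3%N ->
        solutions K = [set (-1, 0)]
    & D = - 3 ->
        solutions K = [set (-1, 0); (- omega s, 0); (- omega s ^+ 2, 0)]].
Proof.
have int0 : ring_of_integers K 0.
  exact: (@integral0 _ _ (intr : {rmorphism int -> K})).
have cube0 (x : K) : x ^+ 3 - 0 ^+ 2 * x + 1 = 0 <-> x ^+ 3 = -1.
  by rewrite expr0n mul0r subr0; split=> [/eqP|->]; rewrite ?addNr // addr_eq0 => /eqP.
have solN1 : solutions K (-1, 0) by split=> //=; apply/cube0; ring.
have pos3 : D = d%:Z -> forall r : rat, D%:~R * r ^+ 2 <> -3.
  move=> -> r h; have : 0 <= d%:R * r ^+ 2 := mulr_ge0 (ler0n _ d) (sqr_ge0 r).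
  by rewrite pmulrn h.
split.
- move=> D2; have Dd : D = d%:Z by case: D_d => // D_d; lia.
  have d2 : d = 2%N by lia.
  have hd : (d %% 4 = 2 \/ d %% 4 = 3)%N by rewrite d2; left.
  have [sD _] := K_s; rewrite D2 in sD.
  have si : ring_of_integers K s.
    exists ('X^2 - 2%:P); first by rewrite monicXnsubC.
    by rewrite rmorphB /= map_polyXn map_polyC /root !hornerE sD subrr.
  apply/seteqP; split=> [[x t] [/= it e]|x]; last first.
    case=> [[->|->]|->] //; split=> //=.
    + by rewrite sD; ring.
    + exact: (@integral_opp _ _ (intr : {rmorphism int -> K})).
    + by rewrite sqrrN sD; ring.
  have ymin : min_unit_gt1 d (Zsqrt_elt d 1 1) by rewrite d2; exact: min_unit_Zsqrt2.
  have nsq := nonsquare_mod4 hd; rewrite Dd in K_s pos3.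
  have [t0|[_ x3]] := root_real d_sqf hd K_s ymin isT it e.
    left; left; rewrite t0; congr pair; apply: (cubeN1_eqN1 K_s nsq (pos3 erefl)).
    by apply/cube0; rewrite t0 in e.
  (* The exceptional case: x = 1 turns the equation into t^2 = 2. *)
  have x1 := cube1_eq1 K_s nsq (pos3 erefl) x3; rewrite x1 in e *.
  have /eqP : t ^+ 2 = s ^+ 2.
    by rewrite sD; apply/eqP; rewrite -subr_eq0 -oppr_eq0 -e; apply/eqP; ring.
  by rewrite eqf_sqr => /orP[] /eqP ->; [left; right | right].
- move=> Dd d2 [hd [a [b [ymin h2 h3]]]].
  have bodd : odd `|b|%N by case: hd => [/h2|/h3] [].
  have nsq := nonsquare_mod4 hd; rewrite Dd in K_s pos3.
  apply/seteqP; split=> [[x t] [/= it e]|x ->] //.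
  have [t0|[] //] := root_real d_sqf hd K_s ymin bodd it e.
  rewrite /= t0; congr pair; apply: (cubeN1_eqN1 K_s nsq (pos3 erefl)).
  by apply/cube0; rewrite t0 in e.
- move=> Dd d3; rewrite Dd in K_s.
  have nsq : nonsquare (- d%:Z) by apply: nonsquare_neg; lia.
  apply/seteqP; split=> [[x t] [/= it e]|x ->] //.
  have t0 := root_imaginary d_gt0 d_sqf K_s it e.
  rewrite /= t0; congr pair; apply: (cubeN1_eqN1 K_s nsq); last by apply/cube0; rewrite t0 in e.
  (* A rational r with d r^2 = 3 would force d = 3, both being square-free. *)
  move=> r; rewrite rmorphN mulNr => /oppr_inj h; apply: d3.
  exact: (square_free_eq (square_free_prime (isT : prime 3)) d_sqf h).
move=> D3; have Dd : D = - d%:Z by case: D_d => // D_d; lia.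
have [sD _] := K_s; rewrite D3 in sD; rewrite Dd in K_s.
have two0 : 2 != 0 :> K by rewrite -(rmorph_nat (in_alg K)) fmorph_eq0.
have w2 : 2 * omega s = -1 + s by rewrite /omega mulrCA divff ?mulr1.
have w22 : 2 * omega s ^+ 2 = -1 - s.
  by apply: (mulfI two0); transitivity ((2 * omega s) ^+ 2); [ring | rewrite w2; ring: sD].
apply/seteqP; split=> [[x t] [/= it e]|x].
  have t0 := root_imaginary d_gt0 d_sqf K_s it e; rewrite t0 in e *.
  move/cube0: e => x3.
  (* Since s^2 = -3, 4 (x^3 + 1) splits into linear factors over K; the last two have roots -omega^2
     and -omega. *)
  have /eqP : (x + 1) * (((2 * x - 1) - s) * ((2 * x - 1) + s)) = 0.
    transitivity (4 * (x ^+ 3 + 1) - (x + 1) * (s ^+ 2 + 3)); first by ring.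
    by rewrite x3 sD; ring.
  rewrite mulf_eq0 => /orP[|]; first by rewrite addr_eq0 => /eqP ->; left; left.
  rewrite mulf_eq0 => /orP[] /eqP h; [right | left; right]; congr pair.
    apply: (mulfI two0); rewrite mulrN w22; apply/eqP; rewrite -subr_eq0 -h; apply/eqP; ring.
  apply: (mulfI two0); rewrite mulrN w2; apply/eqP; rewrite -subr_eq0 -h; apply/eqP; ring.
have w3 : omega s ^+ 3 = 1.
  apply: (mulfI two0); apply: (mulfI two0).
  transitivity ((2 * omega s) * (2 * omega s ^+ 2)); first by ring.
  by rewrite w2 w22; ring: sD.
case=> [[->|->]|->] //; split=> //=; apply/cube0.
  by rewrite exprNn w3; ring.
by rewrite exprNn -exprM mulnC exprM w3; ring.
Qed.
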